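(* Let $X$ be a $2$-generated $C_2$-axet, i.e. $X=\langle a,b\rangle$ for some axes $a,b\in X$. Then $X$ is isomorphic (as an axet) to either (1) $X(n)$ (for some $n\in\mathbb N\cup\{\infty\}$), or (2) $X'(n)$, where $n=3k$ for some $k\in\mathbb N$.
   Context: Actions are right actions. For a group $S$, an $S$-axet $(G,X,\tau)$ consists of a group $G$, a $G$-set $X$ and a map $\tau\colon X\times S\to G$, written $\tau_x(s)$, such that for all $x\in X$, $s,s'\in S$, $g\in G$: $\tau_x(s)\in G_x$ (the stabiliser of $x$); $\tau_x(ss')=\tau_x(s)\tau_x(s')$; and $\tau_{xg}(s)=g^{-1}\tau_x(s)g$. Elements of $X$ are called axes. If $S=C_2$ with generator $s$, write $\tau_x=\tau_x(s)$. A subset $Y\subseteq X$ is closed if it is invariant under $\tau_y(s)$ for all $y\in Y$, $s\in S$; $\langle Y\rangle$ denotes the smallest closed subset containing $Y$. A morphism of $S$-axets $(G,X,\tau)\to(G',X',\tau')$ is a map of sets $\psi\colon X\to X'$ with $\psi(y\tau_x(s))=\psi(y)\tau'_{\psi(x)}(s)$ for all $x,y\in X$, $s\in S$; an isomorphism is a bijective morphism (no isomorphism between $G$ and $G'$ is required). The $C_2$-axet $X(n)$: for $1\le n<\infty$, $G=D_{2n}$ is the dihedral group of order $2n$ acting on the set $X(n)$ of the $n$ vertices of the regular $n$-gon, and $\tau_x$ is the reflection through the vertex $x$; identifying vertices with $\mathbb Z/n\mathbb Z$, $\tau_i\colon j\mapsto 2i-j$. For $n=\infty$, $G=D_\infty$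 acts on $X(\infty)=\mathbb Z$ and $\tau_i\colon j\mapsto 2i-j$. The $C_2$-axet $X'(3k)$, $k\in\mathbb N$: take $X(4k)=\mathbb Z/4k\mathbb Z$ with the action of $D_{4k}$ (order $4k$), the subgroup of $D_{8k}$ generated by all reflections $\tau_i$. It has two orbits (even and odd residues), each of length $2k$. Fold one of the orbits, i.e. replace the even residues by the pairs $\{i,i+2k\}$ of opposite even vertices, leaving the odd residues as they are, and set $\tau_{\{i,i+2k\}}=\tau_i=\tau_{i+2k}$. The result is the axet $X'(3k)$, with group $D_{4k}$ and $3k$ axes. *)

(* Defs.v *)
From HB Require Import structures.
From mathcomp Require Import classical_sets.
From mathcomp Require Import all_boot all_order all_algebra all_fingroup.

Set Implicit Arguments.
Unset Strict Implicit.
Unset Printing Implicit Defensive.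

Import GRing.Theory.
Local Open Scope group_scope.

Record axet (S : groupType) := Axet {
  axet_group : groupType;
  axes :> Type;
  axet_act : axes -> axet_group -> axes;
  axet_tau : axes -> S -> axet_group;
  axet_act1 : forall x, axet_act x 1 = x;
  axet_actM : forall x g h, axet_act x (g * h) = axet_act (axet_act x g) h;
  axet_tau_stab : forall x s, axet_act x (axet_tau x s) = x;
  axet_tauM : forall x s s', axet_tau x (s * s') = axet_tau x s * axet_tau x s';
  axet_tauJ : forall x s g,
    axet_tau (axet_act x g) s = g^-1 * axet_tau x s * g
}.

(* As s ranges over the whole group S, inclusion is the same as equality here. *)
Definition axet_closed S (X : axet S) (Y : set X) : Prop :=
  forall y s, Y y -> forall x, Y x -> Y (axet_act x (axet_tau y s)).

Definition axet_span S (X : axet S) (Y : set X) : set X :=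
  smallest (@axet_closed S X) Y.

Definition axet_morphism S (X X' : axet S) (psi : X -> X') : Prop :=
  forall (x y : X) (s : S),
    psi (axet_act y (axet_tau x s)) = axet_act (psi y) (axet_tau (psi x) s).

Definition axet_iso S (X X' : axet S) : Prop :=
  exists2 psi : X -> X', axet_morphism psi & bijective psi.

(* The group law of 'Z_2 as a groupType is addition, so the generator is 1%R,
   and s |-> t ^+ s is the morphism sending it to the involution t. *)
Definition C2 : groupType := 'Z_2.

Section C2Axet.
Variables (G : groupType) (X : Type) (act : X -> G -> X) (t : X -> G).
Hypotheses (act1 : forall x, act x 1 = x)
  (actM : forall x g h, act x (g * h) = act (act x g) h)
  (t_stab : forall x, act x (t x) = x)
  (t_invol : forall x, t x * t x = 1)
  (tJ : forall x g, t (act x g) = g^-1 * t x * g).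

Definition C2tau (x : X) (s : C2) : G := t x ^+ (s : 'Z_2).

Fact C2tau_stab x s : act x (C2tau x s) = x.
Proof. by rewrite /C2tau; case: s => [[|[|s]] //= _]. Qed.

Fact C2tauM x s s' : C2tau x (s * s') = C2tau x s * C2tau x s'.
Proof.
rewrite /C2tau; case: s => [[|[|s]] //= ?]; case: s' => [[|[|s']] //= ?];
by rewrite ?mul1g ?mulg1 ?t_invol.
Qed.

Fact C2tauJ x s g : C2tau (act x g) s = g^-1 * C2tau x s * g.
Proof.
by rewrite /C2tau; case: s => [[|[|s]] //= _]; rewrite ?mulg1 ?mulVg ?tJ.
Qed.

Definition C2axet : axet C2 :=
  Axet act1 actM C2tau_stab C2tauM C2tauJ.
End C2Axet.

(* The dihedral group of an abelian group A: the pair (a, e) stands for the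
   permutation x |-> a + x (e = false) or x |-> a - x (e = true) of A, acting on
   the right.  For A = Z/n it has order 2n (it is not faithful on A when
   n <= 2), and for A = Z it is D_oo. *)
Definition dihedral (A : zmodType) : Type := (A * bool)%type.

Section Dihedral.
Variable A : zmodType.
Implicit Types g h : dihedral A.

Definition dih_act (x : A) g : A := (g.1 + (if g.2 then - x else x))%R.
Definition dih_one : dihedral A := (0%R, false).
Definition dih_mul g h : dihedral A := (dih_act g.1 h, g.2 (+) h.2).
Definition dih_inv g : dihedral A := ((if g.2 then g.1 else - g.1)%R, g.2).

Fact dih_mulA : associative dih_mul.
Proof.
move=> [a e] [b f] [c d]; rewrite /dih_mul /dih_act /= addbA.
by congr (_, _); case: d; case: f; rewrite /= ?opprD ?opprK ?addrA.
Qed.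
Fact dih_mul1g : left_id dih_one dih_mul.
Proof.
move=> [a e]; rewrite /dih_mul /dih_act /=.
by case: e; rewrite ?oppr0 addr0.
Qed.
Fact dih_mulg1 : right_id dih_one dih_mul.
Proof. by move=> [a e]; rewrite /dih_mul /dih_act /= add0r addbF. Qed.
Fact dih_mulVg : left_inverse dih_one dih_inv dih_mul.
Proof.
by move=> [a []]; rewrite /dih_mul /dih_act /= ?addrN.
Qed.
Fact dih_mulgV : right_inverse dih_one dih_inv dih_mul.
Proof.
by move=> [a []]; rewrite /dih_mul /dih_act /= ?addrN ?addNr.
Qed.

HB.instance Definition _ := Choice.copy (dihedral A) (A * bool)%type.
HB.instance Definition _ :=
  isGroup.Build (dihedral A) dih_mulA dih_mul1g dih_mulg1 dih_mulVg dih_mulgV.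

Definition dih_refl (i : A) : dihedral A := (i *+ 2, true)%R.

Fact dih_act1 x : dih_act x 1 = x.
Proof. exact: add0r. Qed.
Fact dih_actM x g h : dih_act x (g * h) = dih_act (dih_act x g) h.
Proof.
case: g h => [a e] [b f]; rewrite /dih_act /=.
by case: e; case: f; rewrite /= ?opprD ?opprK ?addrA.
Qed.
Fact dih_reflE i j : dih_act j (dih_refl i) = (i *+ 2 - j)%R.
Proof. by []. Qed.
Fact dih_refl_stab i : dih_act i (dih_refl i) = i.
Proof. by rewrite dih_reflE mulr2n addrK. Qed.
Fact dih_refl_invol i : dih_refl i * dih_refl i = 1.
Proof. by congr (_, _); rewrite /dih_act /= subrr. Qed.
Fact dih_reflJ i g : dih_refl (dih_act i g) = g^-1 * dih_refl i * g.
Proof.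
case: g => a []; congr (_, _); rewrite /dih_act /= mulrnDl ?mulNrn.
  by rewrite dih_reflE opprB addrA -mulr2n.
by rewrite dih_reflE opprK [RHS]addrCA -mulr2n addrC.
Qed.

Definition dih_axet : axet C2 :=
  C2axet dih_act1 dih_actM dih_refl_stab dih_refl_invol dih_reflJ.
End Dihedral.

HB.instance Definition _ (A : finZmodType) :=
  Finite.copy (dihedral A) (A * bool)%type.

(* The index is 'I_n.-1.+1 because 'Z_1 would be Z/2Z. *)
Definition X_fin (n : nat) : axet C2 := dih_axet 'I_n.-1.+1.

Definition X_inf : axet C2 := dih_axet int.

Section Folded.
Variable k : nat.
Local Notation Z4k := 'Z_(4 * k).
Implicit Types i j : Z4k.

Definition refl_group : {group dihedral Z4k} :=
  <<[set dih_refl i | i : Z4k]>>%G.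

Definition fold i : {set Z4k} :=
  if odd i then [set i] else [set i; i + (2 * k)%:R]%R.

Definition folded_axes : Type := {B : {set Z4k} | B \in [set fold i | i : Z4k]}.

Fact odd_Zadd i j : odd (i + j)%R = odd i (+) odd j.
Proof.
rewrite /= -oddD; set m := (Zp_trunc _).+2.
have m_even : ~~ odd m.
  by rewrite /m; case: (k) => // p; rewrite Zp_cast mulnS // oddD oddM.
by rewrite [in RHS](divn_eq (i + j) m) oddD oddM (negPf m_even) andbF.
Qed.

Fact odd_Zopp i : odd (- i)%R = odd i.
Proof.
have := odd_Zadd i (- i)%R; rewrite subrr /=.
by case: odd; case: odd.
Qed.

Fact half_turn2 : ((2 * k)%:R + (2 * k)%:R = 0 :> Z4k)%R.
Proof.
case: (k) => [|p]; first by rewrite muln0 addr0.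
by rewrite -natrD addnn -mul2n mulnA (pchar_Zp _) // mulnS.
Qed.

Fact refl_group_even g : g \in refl_group -> ~~ odd g.1.
Proof.
have gH : group_set [set h : dihedral Z4k | ~~ odd h.1].
  apply/group_setP; split=> [|[a e] [b f]]; rewrite !inE //=.
  move=> /negPf a_even /negPf b_even; rewrite odd_Zadd b_even.
  by case: f; rewrite ?odd_Zopp a_even.
suff: refl_group \subset group gH by move=> /subsetP sub /sub; rewrite inE.
rewrite gen_subG; apply/subsetP=> _ /imsetP[i _ ->].
by rewrite inE [_.1]mulr2n odd_Zadd addbb.
Qed.

Fact fold_act g i : g \in refl_group ->
  [set dih_act x g | x in fold i] = fold (dih_act i g).
Proof.
case: g => a e /refl_group_even /= /negPf a_even.
have half_turnN : (- (2 * k)%:R = (2 * k)%:R :> Z4k)%R.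
  by apply/esym/eqP; rewrite -addr_eq0 half_turn2.
have -> : fold (dih_act i (a, e)) =
  if odd i then [set dih_act i (a, e)]
  else [set dih_act i (a, e); dih_act i (a, e) + (2 * k)%:R]%R.
  by rewrite /fold odd_Zadd a_even; case: e; rewrite /= ?odd_Zopp.
rewrite /fold; case: ifP => _; first by rewrite imset_set1.
rewrite imsetU1 imset_set1; congr [set _; _].
by rewrite /dih_act /=; case: e; rewrite ?opprD ?half_turnN addrA.
Qed.

Fact fold_refl i j : i \in fold j -> dih_refl i = dih_refl j.
Proof.
rewrite /fold; case: ifP => _; rewrite !inE; first by move/eqP->.
case/orP=> /eqP-> //.
by rewrite /dih_refl mulrnDl [((2 * k)%:R *+ 2)%R]mulr2n half_turn2 addr0.
Qed.

Fact mem_fold i : i \in fold i.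
Proof. by rewrite /fold; case: ifP => _; rewrite !inE eqxx. Qed.

Fact folded_act_subproof (B : folded_axes) (g : subg_of refl_group) :
  [set dih_act x (sgval g) | x in sval B] \in [set fold i | i : Z4k].
Proof.
by case: B => _ /= /imsetP[i _ ->]; rewrite fold_act ?subgP ?imset_f.
Qed.

Definition folded_act (B : folded_axes) (g : subg_of refl_group) : folded_axes :=
  Sub [set dih_act x (sgval g) | x in sval B] (folded_act_subproof B g).

(* By fold_refl the choice of the element of B is irrelevant, and B is never
   empty. *)
Definition folded_tau (B : folded_axes) : subg_of refl_group :=
  subg refl_group (dih_refl (odflt 0%R [pick i in sval B])).

Fact folded_tauE (B : folded_axes) i :
  sval B = fold i -> sgval (folded_tau B) = dih_refl i.
Proof.
move=> defB; rewrite subgK ?mem_gen ?imset_f // defB.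
by case: pickP => [j /fold_refl // | /(_ i)]; rewrite mem_fold.
Qed.

Implicit Types (B : folded_axes) (g h : subg_of refl_group).

Fact folded_act1 B : folded_act B 1 = B.
Proof.
apply: val_inj => /=; rewrite -[RHS]imset_id.
by apply: eq_imset => x; rewrite dih_act1.
Qed.

Fact folded_actM B g h : folded_act B (g * h) = folded_act (folded_act B g) h.
Proof.
apply: val_inj => /=; rewrite -imset_comp.
by apply: eq_imset => x; rewrite /= dih_actM.
Qed.

Fact folded_tau_stab B : folded_act B (folded_tau B) = B.
Proof.
have /imsetP[i _ defB] := valP B; apply: val_inj => /=.
by rewrite (folded_tauE defB) defB fold_act ?dih_refl_stab ?mem_gen ?imset_f.
Qed.

Fact folded_tau_invol B : folded_tau B * folded_tau B = 1.
Proof.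
have /imsetP[i _ defB] := valP B; apply: val_inj => /=.
by rewrite (folded_tauE defB) dih_refl_invol.
Qed.

Fact folded_tauJ B g : folded_tau (folded_act B g) = g^-1 * folded_tau B * g.
Proof.
have /imsetP[i _ defB] := valP B; apply: val_inj => /=.
have defBg : sval (folded_act B g) = fold (dih_act i (sgval g)).
  by rewrite /= defB fold_act ?subgP.
by rewrite (folded_tauE defBg) (folded_tauE defB) dih_reflJ.
Qed.

(* This is X'(3k), for k > 0; it has 3k axes. *)
Definition X_folded : axet C2 :=
  C2axet folded_act1 folded_actM folded_tau_stab folded_tau_invol folded_tauJ.
End Folded.

(* Main.v *)
Require Import Defs.
From mathcomp Require Import classical_sets.
From mathcomp Require Import all_boot all_order all_algebra all_fingroup.
From mathcomp Require Import boolp.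
From mathcomp Require Import zify.

Set Implicit Arguments.
Unset Strict Implicit.
Unset Printing Implicit Defensive.

Import GRing.Theory.
Local Open Scope ring_scope.

(** Write [reflection x y] for the image of the axis [y] under the involution
    attached to [x].  It satisfies the laws of an involutory quandle, and X(oo),
    which is Z with [j |-> 2i - j], is the free such object on two generators:
    given axes [a] and [b], the sequence with [f 0 = a], [f 1 = b] and
    [f (i + 2) = reflection (f (i + 1)) (f i)] extends to all of Z, and is a
    morphism from X(oo) ([quotient_of_X_inf]).  Its image is closed, so it is
    everything when [a] and [b] generate.

    Hence X is determined by the kernel of [f], a congruence [R] on Z, and it
    remains to list the congruences ([congruence_classification]).  Since
    [R i j] lets one exchange the reflections in [i] and [j], whose product is
    the translation by 2(j - i), it forces [R m (m + 2 (j - i))] for every [m];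
    also [R] is invariant under translation by 2.
    - If [R] identifies two integers of different parity, then it is invariant
      under all translations, so it is congruence modulo some [n], where n = 0 gives X(oo) itself.
    - Otherwise [R] is congruence modulo 2p on the even integers and modulo 2q
      on the odd ones.  Doubling gives p | 2q and q | 2p, which leaves p = q
      (congruence modulo 2p), q = 2p (the kernel of Z -> X'(3p)) or p = 2q (the
      same after the change of variable [i |-> i + 1], which exchanges the two
      generators).

    Two surjective morphisms with the same kernel have isomorphic targets
    ([iso_of_same_kernel]), so it is enough to compute the kernels of the
    canonical maps from Z to X(n) and X'(3k). *)

(** * Reflections and morphisms *)

Definition C2_gen : C2 := (1%R : 'Z_2).

Definition reflection (X : axet C2) (x y : X) : X :=
  axet_act y (axet_tau x C2_gen).

Lemma axet_tau1 S (X : axet S) (x : X) : axet_tau x 1%g = 1%g.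
Proof. by apply: (mulgI (axet_tau x 1%g)); rewrite -axet_tauM !mulg1. Qed.

Lemma reflection_fixed (X : axet C2) (x : X) : reflection x x = x.
Proof. exact: axet_tau_stab. Qed.

Lemma reflectionK (X : axet C2) (x : X) : involutive (reflection x).
Proof.
move=> y; rewrite /reflection -axet_actM -axet_tauM.
have -> : (C2_gen * C2_gen = 1)%g by apply: val_inj.
by rewrite axet_tau1 axet_act1.
Qed.

Lemma reflection_distr (X : axet C2) (x y z : X) :
  reflection x (reflection y z) =
  reflection (reflection x y) (reflection x z).
Proof. by rewrite /reflection axet_tauJ -!axet_actM !mulgA mulgV mul1g. Qed.

(** The identity of C2 acts trivially, so only its generator matters. *)
Lemma reflection_morphism (X Y : axet C2) (psi : X -> Y) :
  (forall x y, psi (reflection x y) = reflection (psi x) (psi y)) ->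
  axet_morphism psi.
Proof.
move=> psi_refl x y s; have [->|->] : s = 1%g \/ s = C2_gen.
- by case: s => [[|[|s]] //= ?]; [left|right]; apply: val_inj.
- by rewrite !axet_tau1 !axet_act1.
- exact: psi_refl.
Qed.

Lemma iso_of_same_kernel S (Z X Y : axet S) (f : Z -> X) (g : Z -> Y) :
  axet_morphism f -> axet_morphism g ->
  (forall x, exists i, f i = x) -> (forall y, exists i, g i = y) ->
  (forall i j, f i = f j <-> g i = g j) -> axet_iso X Y.
Proof.
move=> fM gM f_surj g_surj fg.
pose f' x := projT1 (cid (f_surj x)); pose g' y := projT1 (cid (g_surj y)).
have f'K x : f (f' x) = x by rewrite /f'; case: cid.
have g'K y : g (g' y) = y by rewrite /g'; case: cid.
exists (g \o f') => [x y s|].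
  by rewrite /= -gM; apply/fg; rewrite fM !f'K.
exists (f \o g') => x /=.
  by rewrite -[RHS]f'K; apply/fg; rewrite g'K.
by rewrite -[RHS]g'K; apply/fg; rewrite f'K.
Qed.

(** * A two-generated axet is a quotient of X(oo) *)

(** Iterating [F] from [x] in both directions, [B] serving for the steps to the
    left. *)
Lemma int_orbit T (F B : T -> T) (x : T) : cancel B F ->
  exists2 P : int -> T, P 0 = x & forall i, P (i + 1) = F (P i).
Proof.
move=> BK.
exists (fun i => match i with Posz n => iter n F x | Negz n => iter n.+1 B x end).
  by [].
move=> [n|[|n]]; first by rewrite -PoszD addn1.
  by rewrite /= BK.
have -> : Negz n.+1 + 1 = Negz n by lia.
by rewrite [iter n.+2 _ _]iterS BK.
Qed.

Lemma X_inf_refl (i j : int) : reflection (i : X_inf) (j : X_inf) = i *+ 2 - j.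
Proof. by []. Qed.

(** The bi-infinite sequence is obtained by iterating [F] on pairs of
    consecutive terms.  By construction the reflection in [f i] exchanges
    [f (i - 1)] and [f (i + 1)]; that it exchanges [f (i - m)] and [f (i + m)]
    follows by induction on [m], because by self-distributivity it carries the
    recurrence to the right of [i] to the recurrence to its left. *)
Lemma quotient_of_X_inf (X : axet C2) (a b : X) :
  axet_span [set a; b]%classic = [set: X]%classic ->
  exists2 f : X_inf -> X, axet_morphism f & forall x, exists i, f i = x.
Proof.
move=> spanX.
pose F (p : X * X) := (p.2, reflection p.2 p.1).
pose B (p : X * X) := (reflection p.1 p.2, p.1).
have BK : cancel B F by move=> [x y]; rewrite /F /B /= reflectionK.
have [P P0 PS] := @int_orbit _ F B (a, b) BK.
pose f i := (P i).1.
have PE i : (P i).2 = f (i + 1) by rewrite /f PS.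
have fS i : f (i + 2) = reflection (f (i + 1)) (f i).
  by rewrite -[2]/(1 + 1) addrA /f !PS.
have fpred i : f (i - 1) = reflection (f i) (f (i + 1)).
  have := fS (i - 1).
  have -> : i - 1 + 2 = i + 1 by lia.
  by rewrite subrK => ->; rewrite reflectionK.
have fsub i (m : nat) : reflection (f i) (f (i + m%:Z)) = f (i - m%:Z).
  elim/ltn_ind: m => -[|[|m]] IH.
  - by rewrite addr0 reflection_fixed; congr f; lia.
  - by rewrite fpred.
  have -> : i + m.+2%:Z = i + m%:Z + 2 by lia.
  rewrite fS reflection_distr.
  have -> : i + m%:Z + 1 = i + m.+1%:Z by lia.
  rewrite !IH //.
  have -> : i - m%:Z = i - m.+1%:Z + 1 by lia.
  by rewrite -fpred; congr f; lia.
have fM : axet_morphism (f : X_inf -> X).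
  apply: reflection_morphism => i j; rewrite X_inf_refl.
  have [m [->|->]] : exists m : nat, j = i + m%:Z \/ j = i - m%:Z.
  - by exists `|j - i|%N; lia.
  - by rewrite fsub; congr f; lia.
  - by rewrite -fsub reflectionK; congr f; lia.
exists f => // x.
pose im : set X := (fun x => exists i, f i = x).
suff sub_im : (axet_span [set a; b] `<=` im)%classic.
  by apply: sub_im; rewrite spanX.
apply: smallest_sub => [y s [i <-] z [j <-]|y [->|->]].
- by exists (axet_act (j : X_inf) (axet_tau (i : X_inf) s)); rewrite fM.
- by exists 0; rewrite /f P0.
- by exists 1; rewrite -[1]add0r -PE P0.
Qed.

(** * Congruences of X(oo) *)

Lemma int_subgroup_cyclic (H : int -> Prop) :
  H 0 -> (forall i j, H i -> H j -> H (i - j)) ->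
  exists d : nat, forall i, H i <-> (d %| i)%Z.
Proof.
move=> H0 HB.
have HN i : H i -> H (- i) by rewrite -sub0r; apply: HB.
have HD i j : H i -> H j -> H (i + j).
  by move=> Hi /HN Hj; rewrite -[j]opprK; apply: HB.
have HMn i (n : nat) : H i -> H (n%:Z * i).
  move=> Hi; elim: n => [|n IH]; first by rewrite mul0r.
  by rewrite -addn1 PoszD mulrDl mul1r; apply: HD.
have HM i m : H i -> H (m * i).
  by case: (intP m) => [|n|n] Hi; [rewrite mul0r|apply: HMn|
    rewrite mulNr; apply/HN/HMn].
have [[n Hn]|noH] := pselect (exists n : nat, `[< H n.+1%:Z >]); last first.
  exists 0%N => i; rewrite dvd0z; split=> [Hi|/eqP-> //].
  case: (intP i) Hi => // m Hm; case: noH; exists m; apply/asboolP => //.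
  by rewrite -[_%:Z]opprK; apply: HN.
have [|d /asboolP Hd dmin] := @ex_minnP (fun n => `[< H n.+1%:Z >]).
  by exists n.
exists d.+1 => i; split=> [Hi|/dvdzP[m ->]]; last exact: HM.
apply/dvdz_mod0P.
have Hr : H (i %% d.+1%:Z)%Z.
  by rewrite /modz; apply: HB => //; apply: HM.
have := modz_ge0 i (isT : d.+1%:Z != 0).
have := ltz_pmod i (isT : 0 < d.+1%:Z).
case: (modz _ _) Hr => // -[//|r] Hr lt_rd _.
have : (d <= r)%N by apply: dmin; apply/asboolP.
by move: lt_rd; lia.
Qed.

(** Kernels of morphisms from X(oo): the last clause is compatibility with
    reflections. *)
Definition int_congruence (R : int -> int -> Prop) : Prop :=
  [/\ forall i, R i i, forall i j, R i j -> R j i,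
      forall i j k, R i j -> R j k -> R i k
    & forall i j m n, R i j -> R m n -> R (i *+ 2 - m) (j *+ 2 - n)].

(** The kernel of Z -> X'(3k): congruence modulo 4k, with opposite even vertices
    of the 4k-gon identified. *)
Definition folded_kernel (k : nat) (i j : int) : bool :=
  ((4 * k)%N %| i - j)%Z || (2 %| i)%Z && ((2 * k)%N %| i - j)%Z.

Section Congruence.
Variables (R : int -> int -> Prop) (congR : int_congruence R).

Let Rrefl i : R i i. Proof. by case: congR => + _ _ _; apply. Qed.
Let Rsym i j : R i j -> R j i. Proof. by case: congR => _ + _ _; apply. Qed.
Let Rtrans j i k : R i j -> R j k -> R i k.
Proof. by case: congR => _ _ + _; apply. Qed.
Let Rreflect i j m n : R i j -> R m n -> R (i *+ 2 - m) (j *+ 2 - n).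
Proof. by case: congR => _ _ _; apply. Qed.

(** Translation by [2m] is the product of the reflections in 0 and in [m]. *)
Lemma congr_shift2 m i j : R i j -> R (i + m *+ 2) (j + m *+ 2).
Proof.
move=> /(Rreflect (Rrefl 0)) /(Rreflect (Rrefl m)).
by congr R; lia.
Qed.

(** Reflecting one and the same point in the related points [i] and [j] gives
    images that differ by [2 (j - i)]. *)
Lemma congr_double i j m : R i j -> R m (m + (j - i) *+ 2).
Proof.
move=> /Rreflect/(_ (Rrefl (i *+ 2 - m))).
by congr R; lia.
Qed.

Lemma congr_same_parity i j d : R i (i + d) -> (2 %| j - i)%Z -> R j (j + d).
Proof.
move=> Rid /dvdzP[m def_ji]; have := congr_shift2 m Rid.
by congr R; lia.
Qed.

(** The periods [2t] of the class of [i] form a subgroup, which depends only on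
    the parity of [i]. *)
Lemma congr_parity_class i : exists d : nat,
  forall m t, (2 %| m - i)%Z -> R m (m + t *+ 2) <-> (d %| t)%Z.
Proof.
have [|t u Rt Ru|d Hd] :=
  @int_subgroup_cyclic (fun t => R i (i + t *+ 2)).
- by rewrite mul0rn addr0.
- apply: (@Rtrans (i - u *+ 2)).
    by have := congr_shift2 (- u) Ru; move/Rsym; congr R; lia.
  by have := congr_shift2 (- u) Rt; congr R; lia.
exists d => m t par; rewrite -Hd; split=> Rt.
  by apply: congr_same_parity Rt _; lia.
exact: congr_same_parity Rt par.
Qed.

(** An odd [d] with [R i (i + d)] is a period at every point: at points [j] of
    the parity of [i] by translation; at the others [R (j - d) j] holds, and
    doubling it gives [R (j - d) (j + d)].  Together with invariance under
    translation by 2 this makes [R] invariant under translation by 1, so that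
    [R] is congruence modulo the subgroup of integers related to 0. *)
Lemma congr_odd (d : int) i :
  ~~ (2 %| d)%Z -> R i (i + d) ->
  exists n : nat, forall m j, R m j <-> (n %| m - j)%Z.
Proof.
move=> odd_d Rid.
have Rd j : R j (j + d).
  have [par|par] := boolP (2 %| j - i)%Z; first exact: congr_same_parity Rid par.
  have Rj : R (j - d) j.
    have -> : j = j - d + d by lia.
    rewrite addrK; apply: congr_same_parity Rid _.
    by lia.
  apply: (@Rtrans (j - d)); first exact: Rsym.
  by have := @congr_double _ _ (j - d) Rj; congr R; lia.
(* [m + 1 = (m + 2q) + d] where [2q = 1 - d], and [d] is a period. *)
have shift1 m j : R m j -> R (m + 1) (j + 1).
  have /dvdzP[q def_q] : (2 %| 1 - d)%Z by lia.
  move=> /(congr_shift2 q) Rmj.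
  have -> : m + 1 = m + q *+ 2 + d by lia.
  have -> : j + 1 = j + q *+ 2 + d by lia.
  by apply: Rtrans (Rd _); apply: Rtrans Rmj; apply/Rsym.
have shift t m j : R m j -> R (m + t) (j + t).
  have [q [->|->]] : exists q, t = q *+ 2 \/ t = q *+ 2 + 1.
  - by exists (t %/ 2)%Z; lia.
  - exact: congr_shift2.
  - by rewrite (addrA m) (addrA j) => Rmj; apply: shift1; apply: congr_shift2.
have [|m n Rm Rn|n Hn] := @int_subgroup_cyclic (R 0); first exact: Rrefl.
  apply: (@Rtrans (- n)); last by have := shift (- n) _ _ Rm; rewrite add0r.
  by apply: Rsym; have := shift (- n) _ _ Rn; rewrite add0r subrr.
exists n => m j; rewrite -opprB dvdzE abszN -dvdzE -Hn; split=> [Rmj|R0].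
  by have := shift (- m) _ _ Rmj; rewrite subrr.
by have := shift m _ _ R0; rewrite add0r subrK.
Qed.

(** The divisibilities between [p] and [q] come from [congr_double]: a period
    [2p] at 0 becomes a period [4p] at 1, and conversely. *)
Lemma congr_even :
  (forall m j, R m j -> (2 %| m - j)%Z) ->
  exists p q : nat, [/\ (p %| 2 * q)%N, (q %| 2 * p)%N &
    forall m j, R m j <->
      if (2 %| m)%Z then ((2 * p)%N %| m - j)%Z else ((2 * q)%N %| m - j)%Z].
Proof.
move=> even_R.
have [p Hp] := congr_parity_class 0; have [q Hq] := congr_parity_class 1.
have Rp : R 0 (0 + p%:Z *+ 2) by apply/Hp; rewrite ?dvdzz.
have Rq : R 1 (1 + q%:Z *+ 2) by apply/Hq; rewrite ?dvdzz.
have dvd2M (d t : int) : (2 * d %| t *+ 2)%Z = (d %| t)%Z.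
  by rewrite -[t *+ 2]mulr_natl dvdz_mul2l.
exists p, q; split.
- have := @congr_double _ _ 0 Rq.
  have -> : 1 + q%:Z *+ 2 - 1 = (2 * q)%N%:Z by lia.
  by rewrite Hp.
- have := @congr_double _ _ 1 Rp.
  have -> : 0 + p%:Z *+ 2 - 0 = (2 * p)%N%:Z by lia.
  by rewrite Hq.
move=> m j; split=> [Rmj|].
  have /dvdzP[t def_t] := even_R _ _ Rmj.
  have def_j : j = m + (- t) *+ 2 by lia.
  have -> : m - j = t *+ 2 by lia.
  have dvdN (d : nat) : (d %| t)%Z = (d %| - t)%Z by rewrite rpredN.
  move: Rmj; rewrite !PoszM !dvd2M !dvdN def_j.
  by case: ifPn => par; [rewrite Hp ?subr0|rewrite Hq //; lia].
case: ifPn => par /dvdzP[t def_t].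
  have -> : j = m + (- t * p%:Z) *+ 2 by lia.
  by apply/Hp; [rewrite subr0|exact/dvdz_mull/dvdzz].
have -> : j = m + (- t * q%:Z) *+ 2 by lia.
by apply/Hq; [lia|exact/dvdz_mull/dvdzz].
Qed.
End Congruence.

Lemma folded_kernelE k m j :
  folded_kernel k m j = if (2 %| m)%Z then ((2 * k)%N %| m - j)%Z
                        else ((4 * k)%N %| m - j)%Z.
Proof.
rewrite /folded_kernel; case: ifP => _; last by rewrite orbF.
rewrite orb_idl //; apply: dvdz_trans.
by rewrite dvdzE; apply: dvdn_mul.
Qed.

(** The third case is needed because [folded_kernel] identifies opposite even
    points: it covers the congruences that fold the odd points instead.  In the
    first case [n = 0] is the equality of integers. *)
Lemma congruence_classification R : int_congruence R ->
  [\/ exists n : nat, forall i j, R i j <-> (n %| i - j)%Z,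
      exists2 k : nat, (0 < k)%N & forall i j, R i j <-> folded_kernel k i j
    | exists2 k : nat, (0 < k)%N &
        forall i j, R (i + 1) (j + 1) <-> folded_kernel k i j].
Proof.
move=> congR.
have [[i [d [odd_d Rid]]]|even_R] :=
  pselect (exists i d, ~~ (2 %| d)%Z /\ R i (i + d)).
  by apply: Or31; apply: congr_odd odd_d Rid.
have {}even_R m j : R m j -> (2 %| m - j)%Z.
  move=> Rmj; apply: contraT => odd_mj; case: even_R; exists m, (j - m).
  by split; [lia|rewrite addrC subrK].
have [p [q [p2q q2p Rpq]]] := congr_even congR even_R.
have [p0|p_gt0] := posnP p.
  have q0 : q = 0%N by move: p2q; rewrite p0 dvd0n; lia.
  apply: Or31; exists 0%N => m j; rewrite Rpq p0 q0 muln0.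
  by case: ifP.
have [c def_c] := dvdnP p2q; have [e def_e] := dvdnP q2p.
have [pq|[pq|pq]] : p = q \/ q = (2 * p)%N \/ p = (2 * q)%N.
(* With 2q = cp and 2p = eq, the product [c * e] is 4. *)
- have ce4 : (c * e = 4)%N.
    apply/eqP; rewrite -(eqn_pmul2r p_gt0) mulnAC -def_c.
    by rewrite -mulnA [(q * e)%N]mulnC -def_e mulnA.
  have : (c <= 4)%N by rewrite dvdn_leq // -ce4 dvdn_mulr.
  by case: c def_c ce4 => [|[|[|[|[|c]]]]]; lia.
- apply: Or31; exists (2 * p)%N => m j; rewrite Rpq -pq.
  by case: ifP.
- apply: Or32; exists p => // m j.
  by rewrite folded_kernelE Rpq pq mulnA.
- apply: Or33; exists q => [|m j]; first by lia.
  have -> : folded_kernel q m j =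
      if (2 %| m + 1)%Z then ((2 * p)%N %| (m + 1) - (j + 1))%Z
      else ((2 * q)%N %| (m + 1) - (j + 1))%Z.
    rewrite folded_kernelE.
    have -> : m + 1 - (j + 1) = m - j by lia.
    have -> : (2 %| m + 1)%Z = ~~ (2 %| m)%Z by lia.
    by rewrite if_neg pq mulnA.
  exact: Rpq.
Qed.

(** * The three families as quotients of X(oo) *)

Lemma dih_axet_morphism (A B : zmodType) (u : {additive A -> B}) :
  axet_morphism (u : dih_axet A -> dih_axet B).
Proof.
apply: reflection_morphism => x y.
by rewrite /reflection /= /C2tau /= /dih_act /= raddfB raddfMn.
Qed.

Lemma comp_morphism S (X Y Z : axet S) (psi : X -> Y) (phi : Y -> Z) :
  axet_morphism psi -> axet_morphism phi -> axet_morphism (phi \o psi).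
Proof. by move=> psiM phiM x y s; rewrite /= psiM phiM. Qed.

Lemma fold_in k (i : 'Z_(4 * k)) : fold i \in [set fold j | j : 'Z_(4 * k)].
Proof. exact: imset_f. Qed.

Definition folding k (i : 'Z_(4 * k)) : X_folded k := Sub (fold i) (fold_in i).

Lemma folding_morphism k :
  axet_morphism (@folding k : dih_axet 'Z_(4 * k) -> X_folded k).
Proof.
apply: reflection_morphism => i j; apply: val_inj => /=.
rewrite /C2tau /= expg1.
rewrite (@folded_tauE _ (folding i) i) //.
by rewrite fold_act ?mem_gen ?imset_f.
Qed.

Lemma folding_surj k (B : X_folded k) : exists i, @folding k i = B.
Proof. by have /imsetP[i _ def_B] := valP B; exists i; apply: val_inj. Qed.

Lemma Zp1_mulz_surj n (x : 'I_n.+1) : exists i : int, Zp1 *~ i = x.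
Proof.
exists (x : nat)%:Z; rewrite -pmulrn Zp_mulrn; apply: val_inj => /=.
by rewrite modnMml mul1n modn_small.
Qed.

Lemma Zp1_mulz_eq n (i j : int) :
  (Zp1 *~ i = Zp1 *~ j :> 'I_n.+1) <-> (n.+1 %| i - j)%Z.
Proof.
have eq0 (m : nat) : (Zp1 *+ m == 0 :> 'I_n.+1) = (n.+1 %| m)%N.
  by rewrite Zp_mulrn -val_eqE /= modnMml mul1n.
have -> : (n.+1 %| i - j)%Z = (Zp1 *~ (i - j) == 0 :> 'I_n.+1).
  case: (intP (i - j)) => [|m|m]; first by rewrite mulr0z eqxx dvdz0.
    exact/esym/eq0.
  by rewrite mulrNz oppr_eq0 rpredN; apply/esym/eq0.
by rewrite mulrzBr subr_eq0; split=> /eqP.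
Qed.

Lemma X_fin_quotient n : (0 < n)%N ->
  exists g : X_inf -> X_fin n, [/\ axet_morphism g,
    forall x, exists i, g i = x & forall i j, g i = g j <-> (n %| i - j)%Z].
Proof.
case: n => // n _; exists (intmul (Zp1 : 'I_n.+1)); split.
- exact: (@dih_axet_morphism int 'I_n.+1).
- exact: Zp1_mulz_surj.
- exact: Zp1_mulz_eq.
Qed.

(** [fold i] and [fold j] are equal as soon as [j] lies in [fold i]: for [i]
    even, adding the half turn twice is the identity. *)
Lemma fold_eq k (i j : 'Z_(4 * k)) :
  fold i = fold j <-> (j == i) || ~~ odd i && (j == i + (2 * k)%:R).
Proof.
have -> : (j == i) || ~~ odd i && (j == i + (2 * k)%:R) = (j \in fold i).
  rewrite /fold; case: ifP => _; rewrite !inE /=; last by [].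
  by rewrite orbF.
split=> [->|]; first exact: mem_fold.
have [odd_i|even_i] := boolP (odd i).
  by rewrite {1}/fold odd_i inE => /eqP->.
rewrite {1}/fold (negPf even_i) !inE => /orP[/eqP->//|/eqP->].
rewrite /fold odd_Zadd (negPf even_i).
have -> : odd ((2 * k)%:R : 'Z_(4 * k)) = false.
  by rewrite mul2n -addnn natrD odd_Zadd addbb.
by rewrite /= -addrA half_turn2 addr0 setUC.
Qed.

Lemma X_folded_quotient k : (0 < k)%N ->
  exists g : X_inf -> X_folded k, [/\ axet_morphism g,
    forall x, exists i, g i = x & forall i j, g i = g j <-> folded_kernel k i j].
Proof.
move=> k_gt0; have n_gt1 : (1 < 4 * k)%N by lia.
exists (@folding k \o intmul (1 : 'Z_(4 * k))); split.
- apply: comp_morphism (@folding_morphism k).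
  exact: (@dih_axet_morphism int 'Z_(4 * k)).
- move=> B; have [x <-] := folding_surj B; have [i <-] := Zp1_mulz_surj x.
  by exists i.
move=> i j.
apply: (iff_trans (B := fold (i%:~R : 'Z_(4 * k)) = fold j%:~R)).
  by split=> [/(congr1 val)|?] //; apply: val_inj.
have eqZ (m t : int) : (m%:~R == t%:~R :> 'Z_(4 * k)) = ((4 * k)%N %| m - t)%Z.
  by rewrite -[in RHS](Zp_cast n_gt1); apply/eqP/idP => /Zp1_mulz_eq.
have oddZ (m : int) : ~~ odd (m%:~R : 'Z_(4 * k)) = (2 %| m)%Z.
  have [q [->|->]] : exists q, m = q + q \/ m = q + q + 1.
  - by exists (m %/ 2)%Z; lia.
  - by rewrite intrD odd_Zadd addbb; lia.
  - by rewrite !intrD !odd_Zadd addbb /=; lia.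
have kZ : (2 * k)%:R = (2 * k)%N%:~R :> 'Z_(4 * k) by rewrite -pmulrn.
rewrite fold_eq kZ /folded_kernel oddZ -intrD !eqZ.
rewrite -[j - i]opprB rpredN.
case: (boolP (2 %| i)%Z) => _; last by rewrite !orbF.
(* [2k] divides [i - j] exactly when [4k] divides [i - j] or [i + 2k - j]. *)
split=> /orP[->//|/dvdzP[q def_ij]]; apply/orP.
  by right; apply/dvdzP; exists (- 2 * q - 1); lia.
have [t [q_even|q_odd]] : exists t, q = t + t \/ q = t + t + 1.
- by exists (q %/ 2)%Z; lia.
- by left; apply/dvdzP; exists t; rewrite def_ij q_even; lia.
by right; apply/dvdzP; exists (- t - 1); lia.
Qed.

(** * The classification *)

Theorem theorem1p1 (X : axet C2)
    (hX : exists a b : X, axet_span [set a; b]%classic = [set: X]%classic) :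
  ((exists n : nat, (0 < n)%N /\ axet_iso X (X_fin n)) \/ axet_iso X X_inf) \/
  (exists k : nat, (0 < k)%N /\ axet_iso X (X_folded k)).
Proof.
have [a [b /quotient_of_X_inf[f fM f_surj]]] := hX.
pose R (i j : int) := f i = f j.
have congR : int_congruence R.
  split=> [//|i j /esym//|i j k|i j m n]; first exact: etrans.
  by rewrite /R -!X_inf_refl /reflection !fM => -> ->.
case: (congruence_classification congR) => [[n Rn]|[k k_gt0 Rk]|[k k_gt0 Rk]].
- left; have [n0|n_gt0] := posnP n.
    right; apply: (@iso_of_same_kernel _ X_inf _ _ f id) => // [x|i j].
      by exists x.
    apply: iff_trans (Rn i j) _; rewrite n0 dvd0z subr_eq0.
    by split=> /eqP.
  left; exists n; split=> //.
  have [g [gM g_surj gE]] := X_fin_quotient n_gt0.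
  apply: iso_of_same_kernel fM gM f_surj g_surj _ => i j.
  exact: iff_trans (Rn i j) (iff_sym (gE i j)).
- right; exists k; split=> //.
  have [g [gM g_surj gE]] := X_folded_quotient k_gt0.
  apply: iso_of_same_kernel fM gM f_surj g_surj _ => i j.
  exact: iff_trans (Rk i j) (iff_sym (gE i j)).
(* Here the odd vertices are folded; shifting the indices by 1 makes them even. *)
right; exists k; split=> //.
have [g [gM g_surj gE]] := X_folded_quotient k_gt0.
have shiftM : axet_morphism (fun i : X_inf => (i + 1 : int) : X_inf).
  by apply: reflection_morphism => i j; rewrite !X_inf_refl; lia.
apply: iso_of_same_kernel (comp_morphism shiftM fM) gM _ g_surj _ => [x|i j].
  by have [i <-] := f_surj x; exists (i - 1); rewrite /= subrK.
exact: iff_trans (Rk i j) (iff_sym (gE i j)).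
Qed.
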